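(* Let $\ell$ be an odd prime and $p$ a prime with $\ell\mid p-1$. The $\ell^3$ elements $\alpha_{i,j}^k$, $0\le i,j,k\le \ell-1$, defined below form a basis of the integral closure of $\mathbb{F}_p[t]$ in $\mathcal{R}^{(\ell)}$ as a free $\mathbb{F}_p[t]$-module (an integral basis of $\mathcal{R}^{(\ell)}/\mathbb{F}_p(t)$): $\alpha_{i,j}^0=t^{i/\ell}(1-t)^{j/\ell}$, and for $1\le k\le\ell-1$, $\alpha_{i,j}^k=t^{i/\ell}\,\eta_j^k\,\prod_{n=1}^{\ell-1}(1-\zeta_\ell^{n+j}t^{1/\ell})^{-\lfloor kn/\ell\rfloor}$, which is an $\ell$-th root of $t^{i}\prod_{n=1}^{\ell-1}(1-\zeta_\ell^{n+j}t^{1/\ell})^{\{kn\}}$, where $\{N\}=N-\ell\lfloor N/\ell\rfloor$.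
   Context: Fix a primitive $\ell$-th root of unity $\zeta_\ell\in\mathbb{F}_p$ and let $t$ be transcendental over $\mathbb{F}_p$. Fix $\ell$-th roots $t^{1/\ell}$ and $(1-t)^{1/\ell}$, write $t^{i/\ell}=(t^{1/\ell})^i$, $(1-t)^{j/\ell}=((1-t)^{1/\ell})^j$, and let $\mathcal{K}^{(\ell)}=\mathbb{F}_p(t)(t^{1/\ell},(1-t)^{1/\ell})$. Let $\epsilon_\ell(t)=\prod_{i=1}^{\ell-1}(1-\zeta_\ell^i t^{1/\ell})^i$, fix an $\ell$-th root $\eta=\epsilon_\ell(t)^{1/\ell}$, and let $\mathcal{R}^{(\ell)}=\mathcal{K}^{(\ell)}(\eta)$, a Galois extension of $\mathbb{F}_p(t)$ of degree $\ell^3$. For $0\le j\le\ell-1$ put $\eta_j=\eta\cdot\prod_{m=0}^{j-1}(1-\zeta_\ell^m t^{1/\ell})\cdot (1-t)^{-j/\ell}\in\mathcal{R}^{(\ell)}$; then $\eta_j^\ell=\epsilon_{\ell,j}(t):=\prod_{i=1}^{\ell-1}(1-\zeta_\ell^{i+j}t^{1/\ell})^i$. *)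

(* Defs.v *)
From HB Require Import structures.
From mathcomp Require Import all_boot all_order all_algebra all_field.

Set Implicit Arguments.
Unset Strict Implicit.
Unset Printing Implicit Defensive.

Import GRing.Theory.
Local Open Scope ring_scope.

(* F_p(t), with t the indeterminate 'X; it is F_p(t) only when p is prime. *)
Definition Fpt (p : nat) : fieldType := {fraction {poly 'F_p}}.

(* The structure map F_p[t] -> L of an extension L of F_p(t). *)
Definition polyL (p : nat) (L : fieldExtType (Fpt p)) (a : {poly 'F_p}) : L :=
  (tofrac a : Fpt p)%:A.

Definition constL (p : nat) (L : fieldExtType (Fpt p)) (c : 'F_p) : L :=
  polyL L c%:P.

Definition tL (p : nat) (L : fieldExtType (Fpt p)) : L := polyL L 'X.

(* The subset M of B is a free A-module, with A acting through f : A -> B,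
   and (b i) is a basis of it. *)
Definition is_free_basis (A B : nzRingType) (f : A -> B) (M : B -> Prop)
    (I : finType) (b : I -> B) : Prop :=
  (forall z : B, M z <-> exists c : I -> A, z = \sum_i f (c i) * b i) /\
  (forall c : I -> A, \sum_i f (c i) * b i = 0 -> forall i, c i = 0).

Section Elements.

Variables (l p : nat) (L : fieldExtType (Fpt p)) (zeta : 'F_p).
(* x, y, eta stand for t^(1/l), (1-t)^(1/l) and epsilon_l(t)^(1/l). *)
Variables (x y eta : L).

Definition lin (n : nat) : L := 1 - constL L (zeta ^+ n) * x.

Definition eps : L := \prod_(1 <= i < l) lin i ^+ i.

Definition eta_ (j : nat) : L :=
  eta * (\prod_(0 <= m < j) lin m) * y ^- j.

Definition alpha (i j k : nat) : L :=
  if k == 0%N then x ^+ i * y ^+ j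
  else x ^+ i * eta_ j ^+ k
       * \prod_(1 <= n < l) lin (n + j) ^- ((k * n) %/ l).

Definition fieldK : {subfield L} := <<1 & [:: x; y]>>%AS.

Definition fieldR : {subfield L} := <<fieldK; eta>>%AS.

Definition int_closure (z : L) : Prop :=
  z \in fieldR /\ integralOver (polyL L) z.

End Elements.

(* Main.v *)
(* Put u_n = 1 - zeta^n x with x = t^(1/l). Over F_p(x) the field R is a Kummer
   extension with group (Z/l)^2: y^l is the product of all the u_n and eta^l the
   product of the u_n^n, and comparing multiplicities at the roots of u_0 and
   u_1 shows that y and eta are independent modulo l-th powers. As l is
   invertible in F_p, averaging the Galois conjugates of an integral element
   against characters shows that each of its components f_ab eta^a y^b, with
   f_ab in F_p(x), is integral. Each class eta^a y^b contains some alpha_{0,j}^k,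
   whose l-th power is a product of the coprime u_n with exponents < l; since
   F_p[x] is integrally closed, f alpha_{0,j}^k is integral only if f is in
   F_p[x], which is spanned over F_p[t] by the x^i, i < l. Freeness follows by
   counting: the l^3 elements span R, of degree l^3. *)
Require Import Defs.
From HB Require Import structures.
From mathcomp Require Import all_boot all_order all_algebra all_field.
From mathcomp Require Import zify ring.

Set Implicit Arguments.
Unset Strict Implicit.
Unset Printing Implicit Defensive.

Import GRing.Theory.
Local Open Scope ring_scope.

(** * Kummer theory for adjoining one radical of prime degree *)

Section KummerStep.

Variables (F : fieldType) (L : fieldExtType F) (l : nat) (z : F).
Hypotheses (l_prime : prime l) (z_prim : l.-primitive_root z).
Variables (E : {subfield L}) (w : L).
Hypotheses (wlE : w ^+ l \in E) (wNE : w \notin E).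

Let l_gt0 : (0 < l)%N := prime_gt0 l_prime.

Let w_neq0 : w != 0.
Proof. by apply: contraNneq wNE => ->; rewrite mem0v. Qed.

Let zL_prim : l.-primitive_root (z%:A : L).
Proof. by rewrite (fmorph_primitive_root (in_alg L)). Qed.

Lemma prod_kummer_roots :
  'X^l - (w ^+ l)%:P = \prod_(0 <= i < l) ('X - (w * z%:A ^+ i)%:P).
Proof.
pose rs := [seq w * z%:A ^+ i | i <- index_iota 0 l].
have size_p : size ('X^l - (w ^+ l)%:P) = l.+1 by rewrite size_XnsubC.
have lead_p : lead_coef ('X^l - (w ^+ l)%:P) = 1.
  by apply/eqP; rewrite -monicE monicXnsubC.
rewrite [LHS](@all_roots_prod_XsubC _ _ rs).
- by rewrite lead_p scale1r /rs big_map.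
- by rewrite size_p size_map size_iota subn0.
- apply/allP => _ /mapP[i _ ->]; rewrite rootE !hornerE exprMn exprAC.
  by rewrite (prim_expr_order zL_prim) expr1n mulr1 subrr.
rewrite uniq_rootsE map_inj_in_uniq ?iota_uniq // => i j.
rewrite !mem_index_iota => /andP[_ ltil] /andP[_ ltjl] /(mulfI w_neq0)/eqP.
by rewrite (eq_prim_root_expr zL_prim) !modn_small // => /eqP.
Qed.

(** The minimal polynomial is a product of s of the factors X - w z^i. Its constant coefficient
    forces w^s to lie in E; if s < l, then s is prime to l, and w^s and w^l together put w in E. *)
Lemma minPoly_kummer : minPoly E w = 'X^l - (w ^+ l)%:P.
Proof.
set p := 'X^l - _.
have mon_p : p \is monic by rewrite monicXnsubC.
have size_p : size p = l.+1 by rewrite size_XnsubC.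
have dvd_p : minPoly E w %| p.
  apply: minPoly_dvdp; first by rewrite rpredB ?rpredX ?polyOverX ?polyOverC.
  by rewrite rootE !hornerE subrr.
have [m] := dvdp_prod_XsubC (eq_ind _ (fun q => _ %| q) dvd_p _ prod_kummer_roots).
set s := mask m _; rewrite eqp_monic ?monic_minPoly ?monic_prod_XsubC // => /eqP def_m.
have deg_w : size s = adjoin_degree E w.
  by apply/succn_inj; rewrite -size_minPoly def_m size_prod_XsubC.
have w_deg : w ^+ size s \in E.
  (* The constant coefficient is w^s times a product of nonzero scalars -z^i. *)
  have /polyOverP/(_ 0%N) := minPolyOver E w.
  rewrite def_m -horner_coef0 horner_prod.
  under eq_bigr do rewrite !hornerE -mulrN.
  rewrite big_split big_const_seq count_predT iter_mulr_1 /= => Ew.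
  set c := \prod_(i <- s) _ in Ew.
  have Ec : c \in E.
    by apply: rpred_prod => i _; rewrite rpredN rpredX // rpredZ ?mem1v.
  have c_neq0 : c != 0.
    rewrite prodf_seq_neq0; apply/allP => i _ /=.
    by rewrite oppr_eq0 expf_neq0 // (prim_root_eq0 zL_prim) -lt0n.
  by rewrite -(mulfK c_neq0 (w ^+ _)) rpred_div.
have le_s : (size s <= l)%N.
  by rewrite deg_w -ltnS -size_minPoly -size_p dvdp_leq ?monic_neq0.
have s_gt0 : (0 < size s)%N by rewrite deg_w.
have [lt_s | ge_s] := ltnP (size s) l; last first.
  apply/eqP; rewrite -eqp_monic ?monic_minPoly // -dvdp_size_eqp //.
  by rewrite size_minPoly size_p -deg_w eqn_leq !ltnS ge_s le_s.
case/negP: wNE.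
have [u v def_gcd _] := egcdnP l s_gt0.
have cop : gcdn (size s) l = 1%N.
  by apply/eqP; rewrite -/(coprime _ _) coprime_sym prime_coprime // gtnNdvd.
(* Bezout: [u * size s = v * l + 1]. *)
have -> : w = (w ^+ size s) ^+ u / (w ^+ l) ^+ v.
  rewrite -!exprM mulnC def_gcd cop addn1 exprSr [(l * v)%N]mulnC.
  by rewrite mulrAC divff ?mul1r // expf_neq0.
by apply: rpred_div; apply: rpredX.
Qed.

Lemma adjoin_degree_kummer : adjoin_degree E w = l.
Proof. by apply/succn_inj; rewrite -size_minPoly minPoly_kummer size_XnsubC. Qed.

(** z^i w is another root of the minimal polynomial X^l - w^l, so the identity of E extends by
    sending w to it. *)
Lemma kummer_hom i : exists2 f : 'End(L), kHom E <<E; w>> f & f w = z%:A ^+ i * w.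
Proof.
have rt : root (map_poly (\1%VF : 'End(L)) (minPoly E w)) (z%:A ^+ i * w).
  rewrite (kHom_poly_id (kHom1 E E)) ?minPolyOver // minPoly_kummer.
  rewrite rootE !hornerE exprMn exprAC (prim_expr_order zL_prim).
  by rewrite expr1n mul1r subrr.
exists (kHomExtend E \1 w (z%:A ^+ i * w)).
  by apply: kHomExtendP; rewrite ?kHom1.
exact: (kHomExtend_val (kHom1 E E)).
Qed.

Lemma kummer_span v : v \in <<E; w>>%VS ->
  v = \sum_(i < l) (Fadjoin_poly E w v)`_i * w ^+ i.
Proof.
move=> Ev; rewrite -{1}(Fadjoin_poly_eq Ev) -adjoin_degree_kummer.
by rewrite (horner_coef_wide _ (size_Fadjoin_poly _ _ _)).
Qed.

(* Averaging the conjugates of the sum against the characters of the Galois group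
   isolates each e i * w ^+ i. *)
Lemma kummer_component (P : L -> Prop) (e : nat -> L) :
    (forall i, e i \in E) ->
    P 0 -> (forall u v, P u -> P v -> P (u + v)) ->
    (forall c u, P u -> P (z ^+ c *: u)) -> (forall u, P u -> P (l%:R^-1 *: u)) ->
    (forall f : 'End(L), kHom E <<E; w>> f -> P (f (\sum_(i < l) e i * w ^+ i))) ->
  forall i, (i < l)%N -> P (e i * w ^+ i).
Proof.
have l_neq0 := prim_root_natf_neq0 z_prim.
move=> eE P0 PD PZ Pl Pf a lt_al; set v := \sum_(i < l) _ in Pf.
have conj_v r : exists2 f : 'End(L), kHom E <<E; w>> f &
    f v = \sum_(i < l) z ^+ (r * i) *: (e i * w ^+ i).
  have [f homf fw] := kummer_hom r; exists f => //.
  have [idf fM] := kHomP_tmp homf.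
  have Ew u : u \in E -> u \in <<E; w>>%VS by apply/subvP/subv_adjoin.
  have fX n : f (w ^+ n) = (z%:A ^+ r * w) ^+ n.
    elim: n => [|n IHn]; first by rewrite !expr0 idf ?mem1v.
    by rewrite !exprS fM ?rpredX ?memv_adjoin // fw IHn.
  rewrite linear_sum; apply: eq_bigr => i _ /=.
  rewrite fM ?rpredX ?memv_adjoin ?Ew // idf // fX exprMn -exprM.
  by rewrite -(rmorphXn (in_alg L)) /= mulr_algl -scalerAr.
(* The exponent [r * (l - a)] plays the role of -ra. After exchanging the sums, each index i other
   than a contributes a vanishing geometric sum, and i = a contributes l equal terms. *)
pose S := \sum_(r < l) z ^+ (r * (l - a)) *: 
   \sum_(i < l) z ^+ (r * i) *: (e i * w ^+ i).
have -> : e a * w ^+ a = l%:R^-1 *: S.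
  rewrite /S; under eq_bigr do rewrite scaler_sumr.
  rewrite exchange_big /= (bigD1 (Ordinal lt_al)) //= [X in _ + X]big1 => [|i ne_ia].
    rewrite addr0 (eq_bigr (fun=> e a * w ^+ a)) => [|r _].
      by rewrite sumr_const card_ord -scaler_nat scalerA mulVf ?scale1r.
    rewrite scalerA -exprD -mulnDr subnK ?(ltnW lt_al) // mulnC exprM.
    by rewrite (prim_expr_order z_prim) expr1n scale1r.
  under eq_bigr do rewrite scalerA -exprD -mulnDr mulnC exprM.
  rewrite -scaler_suml; set q := z ^+ _.
  have q_neq1 : q != 1.
    rewrite /q -(prim_order_dvd z_prim); apply: contra ne_ia => /dvdnP[k dk].
    apply/eqP/val_inj => /=; have lt_il := ltn_ord i.
    (* Since 0 < l - a + i < 2l, the only possible multiple of l is l itself, which means i = a. *)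
    move: dk lt_il lt_al; case: k => [|[|k]] dk; [lia | lia | ].
    by move: dk; rewrite !mulSn; lia.
  have : (q - 1) * \sum_(r < l) q ^+ r = 0.
    by rewrite -subrX1 /q exprAC (prim_expr_order z_prim) expr1n subrr.
  move/eqP; rewrite mulf_eq0 subr_eq0 (negPf q_neq1) => /eqP ->.
  by rewrite scale0r.
apply: Pl; rewrite /S; apply: (big_ind P) => // r _.
by apply: PZ; have [f homf <-] := conj_v r; apply: Pf.
Qed.

(** Every conjugate of v over E is a root of unity times v, so the F-line through v is stable under
    conjugation. By [kummer_component] it contains each component of v, and a nonzero component then
    determines v up to a scalar. *)
Lemma kummer_radical v : v \in <<E; w>>%VS -> v ^+ l \in E -> v != 0 ->
  exists2 b, (b < l)%N & exists2 f, f \in E & v = f * w ^+ b.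
Proof.
move=> Ev vlE v_neq0; have def_v := kummer_span Ev.
have eE := polyOverP (Fadjoin_polyOver E w v).
set e := fun i : nat => (Fadjoin_poly E w v)`_i in def_v eE.
pose P u := exists c : F, u = c *: v.
have /existsP[b eb_neq0] : [exists b : 'I_l, e b * w ^+ b != 0].
  apply: contraNT v_neq0 => /existsPn e0; rewrite def_v big1 // => i _.
  by apply/eqP; have := e0 i; rewrite negbK.
have [] : P (e b * w ^+ b).
  apply: (kummer_component (P := P)) => //.
  - by exists 0; rewrite scale0r.
  - by move=> _ _ [c ->] [d ->]; exists (c + d); rewrite scalerDl.
  - by move=> i _ [c ->]; exists (z ^+ i * c); rewrite scalerA.
  - by move=> _ [c ->]; exists (l%:R^-1 * c); rewrite scalerA.
  move=> f homf; rewrite -def_v; have [idf fM] := kHomP_tmp homf.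
  have fX n : f (v ^+ n) = f v ^+ n.
    elim: n => [|n IHn]; first by rewrite !expr0 idf ?mem1v.
    by rewrite !exprS fM ?rpredX // IHn.
  have /(prim_rootP zL_prim)[i] : (f v / v) ^+ l = 1.
    by rewrite expr_div_n -fX idf // divff // expf_neq0.
  move/(canRL (divfK v_neq0)) ->; exists (z ^+ i).
  by rewrite -(rmorphXn (in_alg L)) /= mulr_algl.
move=> c def_eb; have c_neq0 : c != 0.
  by apply: contraNneq eb_neq0 => c0; rewrite def_eb c0 scale0r.
exists b => //; exists (c^-1 *: e b); first by rewrite rpredZ.
by rewrite -scalerAl def_eb scalerA mulVf ?scale1r.
Qed.

End KummerStep.

(** * Multiplicities of roots in products of the factors 1 - z^n X *)

Section LinearFactors.

Variables (k : fieldType) (l : nat) (z : k).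
Hypotheses (l_gt0 : (0 < l)%N) (z_prim : l.-primitive_root z).

Lemma mupX (c : k) (q : {poly k}) n :
  q != 0 -> mup c (q ^+ n) = (n * mup c q)%N.
Proof.
move=> q_neq0; elim: n => [|n IHn]; first by rewrite expr0 mupNroot ?root1.
by rewrite exprS mupM ?expf_neq0 // IHn mulSn.
Qed.

Lemma mup_prod (c : k) (I : Type) (r : seq I) (q : I -> {poly k}) :
  (forall i, q i != 0) -> mup c (\prod_(i <- r) q i) = (\sum_(i <- r) mup c (q i))%N.
Proof.
move=> q_neq0; elim: r => [|i r IHr]; first by rewrite !big_nil mupNroot ?root1.
rewrite !big_cons mupM ?IHr // prodf_seq_neq0.
by apply: sub_all (all_predT r) => j _; apply: q_neq0.
Qed.

(** Polynomial model of [lin]: there the multiplicity of a root makes sense. Its only root is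
    z^-n. *)
Definition linpoly n : {poly k} := 1 - z ^+ n *: 'X.

Let z_neq0 : z != 0.
Proof. by rewrite (prim_root_eq0 z_prim) -lt0n. Qed.

Lemma linpolyE n : linpoly n = - z ^+ n *: ('X - (z ^- n)%:P).
Proof.
by rewrite scalerBr -mul_polyC -[X in _ - X]mul_polyC -polyCM mulNr mulfV
   ?expf_neq0 // polyCN mulNr mul_polyC polyCN opprK addrC.
Qed.

Lemma linpoly_neq0 n : linpoly n != 0.
Proof.
by rewrite linpolyE scaler_eq0 oppr_eq0 expf_eq0 (negPf z_neq0) andbF
  polyXsubC_eq0.
Qed.

Lemma linpoly_mod n : linpoly (n %% l) = linpoly n.
Proof. by rewrite /linpoly (prim_expr_mod z_prim). Qed.

Lemma mup_linpoly m n : mup (z ^- m) (linpoly n) = (n == m %[mod l]).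
Proof.
rewrite linpolyE -mul_polyC mupMr; last first.
  by rewrite rootC oppr_eq0 expf_neq0.
rewrite (mup_XsubCX 1) (inj_eq invr_inj) (eq_prim_root_expr z_prim).
by case: (_ == _).
Qed.

(** Raising j by one permutes the factors cyclically because z^l = 1. For j = 0 both sides are
    multiples of the product of the X - z^-i. *)
Lemma prod_linpoly j : \prod_(0 <= n < l) linpoly (n + j) = 1 - 'X^l.
Proof.
elim: j => [|j <-]; last first.
  rewrite -(prednK l_gt0) big_nat_recr //= big_nat_recl //= mulrC addnS -addSn.
  rewrite prednK //; congr (_ * _); last by apply: eq_bigr => i _; rewrite addSnnS.
  by rewrite -linpoly_mod modnDl linpoly_mod.
pose rs := [seq z ^- i | i <- index_iota 0 l].
have size_p : size (1 - 'X^l : {poly k}) = l.+1.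
  by rewrite -opprB size_polyN size_XnsubC.
have [c def_c] : exists c, 1 - 'X^l = c *: \prod_(r <- rs) ('X - r%:P).
  exists (lead_coef (1 - 'X^l)); apply: all_roots_prod_XsubC.
  - by rewrite size_p size_map size_iota subn0.
  - apply/allP => _ /mapP[i _ ->].
    by rewrite rootE !hornerE exprVn exprAC (prim_expr_order z_prim) expr1n invr1 subrr.
  rewrite uniq_rootsE map_inj_in_uniq ?iota_uniq // => i i'.
  rewrite !mem_index_iota => /andP[_ ltil] /andP[_ lti'l] /invr_inj/eqP.
  by rewrite (eq_prim_root_expr z_prim) !modn_small // => /eqP.
have [d def_d] : exists d, \prod_(0 <= n < l) linpoly (n + 0)
    = d *: \prod_(r <- rs) ('X - r%:P).
  exists (\prod_(0 <= n < l) - z ^+ n); rewrite big_map -scaler_prod.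
  by apply: eq_bigr => n _; rewrite addn0 linpolyE.
(* Both sides have constant coefficient 1, which makes the two scalars equal. *)
have c0 : c * (\prod_(r <- rs) ('X - r%:P)).[0] = 1.
  by rewrite -hornerZ -def_c !hornerE expr0n gtn_eqF // subr0.
have d0 : d * (\prod_(r <- rs) ('X - r%:P)).[0] = 1.
  rewrite -hornerZ -def_d horner_prod big1 // => n _.
  by rewrite !hornerE subr0.
rewrite def_c def_d; congr (_ *: _); apply: (mulIf _ (etrans d0 (esym c0))).
by apply: contra_eq_neq c0 => ->; rewrite mulr0 eq_sym oner_neq0.
Qed.

Lemma mup_prod_linpoly j (e : nat -> nat) n : (n < l)%N ->
  mup (z ^- (n + j)) (\prod_(0 <= i < l) linpoly (i + j) ^+ e i) = e n.
Proof.
move=> lt_nl; rewrite mup_prod => [|i]; last by rewrite expf_neq0 ?linpoly_neq0.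
rewrite big_mkord (bigD1 (Ordinal lt_nl)) //= big1 => [|i ne_in];
  rewrite mupX ?linpoly_neq0 //.
  by rewrite mup_linpoly eqxx muln1 addn0.
rewrite -val_eqE /= in ne_in.
by rewrite mup_linpoly eqn_modDr !modn_small // (negPf ne_in) muln0.
Qed.

(** A root of h at some z^-(n+j) would have multiplicity at least l in the product, where it is e n
    < l. So h is coprime to every factor, hence to the product, which it divides. *)
Lemma linpoly_powerfree j (e : nat -> nat) (h : {poly k}) :
    (forall n, (n < l)%N -> (e n < l)%N) ->
    h ^+ l %| \prod_(0 <= n < l) linpoly (n + j) ^+ e n ->
  size h = 1%N.
Proof.
move=> lt_el; set P := \prod_(_ <= _ < _) _ => dvd_hP.
have P_neq0 : P != 0.
  by rewrite prodf_seq_neq0; apply/allP => i _; rewrite expf_neq0 ?linpoly_neq0.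
have [q def_P] := dvdpP _ _ dvd_hP.
have /norP[q_neq0 hl_neq0] : ~~ ((q == 0) || (h ^+ l == 0)).
  by rewrite -mulf_eq0 -def_P.
have h_neq0 : h != 0 by move: hl_neq0; rewrite expf_eq0 l_gt0.
have cop_h n : (n < l)%N -> coprimep h (linpoly (n + j)).
  move=> lt_nl; rewrite linpolyE coprimepZr ?oppr_eq0 ?expf_neq0 //.
  rewrite coprimep_XsubC -dvdp_XsubCl XsubC_dvd // -leqNgt leqn0 -leqn0 -ltnS.
  rewrite -(ltn_pmul2l l_gt0) muln1 -mupX // (leq_ltn_trans _ (lt_el n lt_nl)) //.
  by rewrite -(mup_prod_linpoly j e lt_nl) -/P def_P mupM // leq_addl.
have cop_hP : coprimep h P.
  rewrite /P big_mkord; apply: (big_ind (coprimep h)); first exact: coprimep1.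
    by move=> u v hu hv; rewrite coprimepMr hu.
  by move=> i _; rewrite coprimep_expr ?cop_h.
have dvd_h : h %| P by rewrite (dvdp_trans _ dvd_hP) // -{1}(expr1 h) dvdp_exp2l.
by apply/eqP; rewrite -coprimepp; apply: coprimep_dvdl dvd_h cop_hP.
Qed.

End LinearFactors.

(** * The field F_p(x) and its integrally closed subring F_p[x] *)

HB.instance Definition _ (p : nat) (L : fieldExtType (Fpt p)) :=
  GRing.RMorphism.copy (@polyL p L) (in_alg L \o @tofrac _).
HB.instance Definition _ (p : nat) (L : fieldExtType (Fpt p)) :=
  GRing.RMorphism.copy (@constL p L) (@polyL p L \o polyC).

Lemma fraction_div (R : idomainType) (a : {fraction R}) :
  exists n d : R, d != 0 /\ a = tofrac n / tofrac d.
Proof.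
elim/quotW: a => r; exists \n_r, \d_r; split; first exact: denom_ratioP.
have d_neq0 : tofrac \d_r != 0 by rewrite tofrac_eq0 denom_ratioP.
apply/(mulIf d_neq0); rewrite divfK //.
rewrite -[LHS]/(FracField.mul _ _) !piE; apply/eqmodP.
rewrite /= FracField.equivfE /FracField.mulf.
by rewrite !numden_Ratio ?mulf_neq0 ?oner_neq0 ?denom_ratioP // !mulr1 mulrC.
Qed.

Section RationalSubfield.

Variables (p l : nat) (L : fieldExtType (Fpt p)) (x : L).
Hypotheses (l_prime : prime l) (x_root : x ^+ l = tL L).

Let l_gt0 : (0 < l)%N := prime_gt0 l_prime.

Lemma comm_const : commr_rmorph (@constL p L) x.
Proof. by move=> c; apply: mulrC. Qed.

(** Injective by [ev_inj], it identifies F_p[x] with a polynomial ring, so that divisibility and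
    multiplicities can be used inside L. *)
Definition ev : {poly 'F_p} -> L := horner_morph comm_const.

HB.instance Definition _ := GRing.RMorphism.on ev.

Lemma evX : ev 'X = x. Proof. exact: horner_morphX. Qed.
Lemma evC c : ev c%:P = constL L c. Proof. exact: horner_morphC. Qed.
Lemma evZ c h : ev (c *: h) = constL L c * ev h.
Proof. by rewrite -mul_polyC rmorphM /= evC. Qed.

Lemma polyL_inj : injective (@polyL p L).
Proof.
move=> g h /(@fmorph_inj _ _ (in_alg L)) /eqP.
by rewrite tofrac_eq => /eqP.
Qed.

(** As t = x^l, the inclusion of F_p[t] in F_p[x] is the substitution of X^l. *)
Lemma ev_comp_Xn h : ev (h \Po 'X^l) = polyL L h.
Proof.
elim/poly_ind: h => [|h c IHh]; first by rewrite comp_poly0 !rmorph0.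
rewrite comp_polyD comp_polyM comp_polyX comp_polyC !rmorphD !rmorphM /= IHh evC.
by rewrite rmorphXn /= evX x_root.
Qed.

(** If x were algebraic over F_p, so would be its power t, which is transcendental. *)
Lemma ev_inj : injective ev.
Proof.
apply: raddf_inj => h eh0; apply: contraTeq isT => h_neq0.
have alg_x : algebraicOver (@constL p L) x.
  by exists h => //; apply/eqP.
have [q q_neq0 /eqP] : algebraicOver (@constL p L) (tL L).
  rewrite -x_root; elim: (l) => [|n IHn]; first exact: algebraic1.
  by rewrite exprS; apply: algebraic_mul.
rewrite (_ : _.[_] = polyL L q) => [/eqP|].
  by rewrite -(rmorph0 (@polyL p L)) (inj_eq polyL_inj) (negPf q_neq0).
rewrite (map_poly_comp (@polyL p L) polyC) horner_map /=; congr (polyL _ _).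
exact: (comp_polyXr q).
Qed.

Lemma ev_eq0 h : (ev h == 0) = (h == 0).
Proof. by rewrite -(rmorph0 ev) (inj_eq ev_inj). Qed.

Lemma ev_mem h : ev h \in <<1; x>>%VS.
Proof.
apply/Fadjoin1_polyP; exists (map_poly (fun c => tofrac c%:P) h).
by rewrite -map_poly_comp.
Qed.

(** Quotients of values of [ev] are closed under sums and products and contain x and F_p(t), hence
    contain all polynomials in x over F_p(t). Dividing by the gcd makes the quotient reduced. *)
Lemma ratP f : f \in <<1; x>>%VS ->
  exists h1 h2, [/\ h2 != 0, coprimep h2 h1 & f = ev h1 / ev h2].
Proof.
pose rat f := exists h1 h2, h2 != 0 /\ f = ev h1 / ev h2.
have ratD u v : rat u -> rat v -> rat (u + v).
  move=> [h1 [h2 [h2_neq0 ->]]] [g1 [g2 [g2_neq0 ->]]].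
  exists (h1 * g2 + g1 * h2), (h2 * g2); rewrite mulf_neq0 //; split=> //.
  by rewrite addf_div ?ev_eq0 // rmorphD !rmorphM.
have ratM u v : rat u -> rat v -> rat (u * v).
  move=> [h1 [h2 [h2_neq0 ->]]] [g1 [g2 [g2_neq0 ->]]].
  by exists (h1 * g1), (h2 * g2); rewrite mulf_neq0 // !rmorphM mulf_div.
have rat_ev h : rat (ev h) by exists h, 1; rewrite oner_neq0 rmorph1 divr1.
case/Fadjoin1_polyP => q ->.
have [h1 [h2 [h2_neq0 ->]]] : rat (map_poly (in_alg L) q).[x].
  rewrite horner_coef size_map_poly; apply: (big_ind rat) => //.
    by rewrite -(rmorph0 ev).
  move=> i _; apply: ratM; last by rewrite -evX -rmorphXn.
  rewrite coef_map /=; have [n [d [d_neq0 ->]]] := fraction_div q`_i.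
  exists (n \Po 'X^l), (d \Po 'X^l).
  rewrite -ev_eq0 !ev_comp_Xn -(rmorph0 (@polyL p L)) (inj_eq polyL_inj).
  by split=> //; apply: (fmorph_div (in_alg L)).
set g := gcdp h2 h1; have g_neq0 : g != 0 by rewrite gcdp_eq0 negb_and h2_neq0.
have def_h2 : h2 = h2 %/ g * g by rewrite divpK ?dvdp_gcdl.
have def_h1 : h1 = h1 %/ g * g by rewrite divpK ?dvdp_gcdr.
exists (h1 %/ g), (h2 %/ g); split.
- by apply: contraNneq h2_neq0 => h20; rewrite def_h2 h20 mul0r.
- by rewrite coprimep_div_gcd ?h2_neq0.
by rewrite {1}def_h1 {1}def_h2 !rmorphM -mulf_div divff ?mulr1 ?ev_eq0.
Qed.

(** With f = h1/h2 the relation reads P h2^l = h1^l Q, and l-th powers change multiplicities only by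
    multiples of l. *)
Lemma mup_mod_radical f (P Q : {poly 'F_p}) c :
    f \in <<1; x>>%VS -> P != 0 -> Q != 0 -> ev P = f ^+ l * ev Q ->
  mup c P = mup c Q %[mod l].
Proof.
move=> /ratP[h1 [h2 [h2_neq0 _ ->]]] P_neq0 Q_neq0.
have ev_neq0 : ev h2 ^+ l != 0 by rewrite expf_neq0 ?ev_eq0.
move/(congr1 ( *%R^~ (ev h2 ^+ l))); rewrite expr_div_n mulrAC divfK //.
rewrite -!rmorphXn -!rmorphM => /ev_inj def_PQ.
have h1_neq0 : h1 != 0.
  apply: contraTneq (mulf_neq0 P_neq0 (expf_neq0 l h2_neq0)) => h1_0.
  by rewrite def_PQ h1_0 expr0n gtn_eqF // mul0r eqxx.
have := congr1 (mup c) def_PQ; rewrite !mupM ?expf_neq0 // !mupX //.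
by rewrite addnC => eq_mup; rewrite -(modnMDl (mup c h2)) mulnC eq_mup mulnC modnMDl.
Qed.

(** If x = n/d in F_p(t), then n^l = t d^l, and the multiplicities at 0 are 0 and 1 modulo l. *)
Lemma x_notin_base : x \notin 1%VS.
Proof.
apply/negP => /vlineP[a def_x]; have [n [d [d_neq0 def_a]]] := fraction_div a.
have := x_root; rewrite def_x -(rmorphXn (in_alg L)) /tL /polyL.
move/(fmorph_inj (in_alg L))/(congr1 ( *%R^~ (tofrac d ^+ l))).
rewrite def_a expr_div_n divfK ?expf_neq0 ?tofrac_eq0 //.
rewrite -!rmorphXn -rmorphM => /eqP; rewrite tofrac_eq => /eqP def_nd.
have X_neq0 : 'X != 0 :> {poly 'F_p} by rewrite polyX_eq0.
have n_neq0 : n != 0.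
  apply: contraTneq (mulf_neq0 X_neq0 (expf_neq0 l d_neq0)) => n0.
  by rewrite -def_nd n0 expr0n gtn_eqF // eqxx.
have := congr1 (mup 0) def_nd; rewrite mupM ?expf_neq0 // !mupX //.
rewrite -['X]subr0 (mup_XsubCX 1) eqxx => /(congr1 (modn^~ l)).
by rewrite mulnC modnMl addnC mulnC modnMDl modn_small ?prime_gt1.
Qed.

Lemma integral_ev h : integralOver (@polyL p L) (ev h).
Proof.
have int_x : integralOver (@polyL p L) x.
  apply: (integral_root_monic (p := 'X^l - (tL L)%:P)).
  - by rewrite monicXnsubC.
  - by rewrite rootE !hornerE x_root subrr.
  apply/integral_poly => i; rewrite coefB coefXn coefC; apply: integral_sub.
    exact: integral_nat.
  by case: (i == 0)%N; [apply: integral_id | apply: integral0].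
rewrite /ev /horner_morph; apply: integral_horner => //.
by apply/integral_poly => i; rewrite coef_map; apply: integral_id.
Qed.

(** Rational root argument: clearing denominators in the monic equation gives h2 | h1^n, so h2,
    coprime to h1, is constant. *)
Lemma integral_rational f : f \in <<1; x>>%VS -> integralOver (@polyL p L) f ->
  exists h, f = ev h.
Proof.
move=> /ratP[h1 [h2 [h2_neq0 cop_h ->]]] [q mon_q].
set n := (size q).-1; have size_q : size q = n.+1.
  by rewrite prednK // size_poly_gt0 monic_neq0.
rewrite rootE => /eqP qf0.
have : ev (\sum_(i < n.+1) (q`_i \Po 'X^l) * (h1 ^+ i * h2 ^+ (n - i))) = 0.
  rewrite -[RHS](mul0r (ev h2 ^+ n)) -qf0 (horner_coef_wide _ (n := n.+1)); last first.
    by rewrite -size_q size_poly.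
  rewrite rmorph_sum mulr_suml; apply: eq_bigr => i _ /=.
  rewrite !rmorphM !rmorphXn /= ev_comp_Xn coef_map -mulrA expr_div_n.
  have -> : ev h2 ^+ n = ev h2 ^+ (n - i) * ev h2 ^+ i.
    by rewrite -exprD subnK // -ltnS.
  by congr (_ * _); rewrite mulrA [_ / _ * _]mulrAC divfK ?expf_neq0 ?ev_eq0.
move/eqP; rewrite ev_eq0 big_ord_recr /= subnn mulr1.
have -> : q`_n = 1 by rewrite /n -lead_coefE (monicP mon_q).
rewrite comp_polyC mul1r addrC addr_eq0 => /eqP def_h1n.
have dvd_h2 : h2 %| h1 ^+ n.
  rewrite def_h1n dvdpNr; apply: (big_ind (fun u => h2 %| u)).
  - exact: dvdp0.
  - by move=> u v; apply: dvdp_add.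
  move=> i _; rewrite /= -[(n - i)%N]prednK ?subn_gt0 // exprS.
  by do 2!apply: dvdp_mull; apply: dvdp_mulr.
have /size_poly1P[c c_neq0 def_h2] : size h2 == 1%N.
  by rewrite -coprimepp (coprimep_dvdl dvd_h2) ?coprimep_expr.
exists (c^-1 *: h1); rewrite evZ def_h2 evC.
by rewrite -(fmorphV (@constL p L)) mulrC.
Qed.

(** The l-th power of f w is integral and lies in F_p(x), hence in F_p[x]. With f = h1/h2 reduced,
    h2^l divides the product, so h2 is constant by [linpoly_powerfree]. *)
Lemma integral_rational_powerfree (z : 'F_p) f w j (e : nat -> nat) :
    l.-primitive_root z -> f \in <<1; x>>%VS ->
    (forall n, (n < l)%N -> (e n < l)%N) ->
    w ^+ l = ev (\prod_(0 <= n < l) linpoly z (n + j) ^+ e n) ->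
    integralOver (@polyL p L) (f * w) ->
  exists h, f = ev h.
Proof.
move=> z_prim fx lt_el; set P := \prod_(_ <= _ < _) _ => def_wl int_fw.
have [h def_h] : exists h, f ^+ l * ev P = ev h.
  apply: integral_rational; first by rewrite rpredM ?rpredX ?ev_mem.
  rewrite -def_wl -exprMn; elim: (l) => [|n IHn]; first exact: integral1.
  by rewrite exprS; apply: integral_mul.
have [h1 [h2 [h2_neq0 cop_h def_f]]] := ratP fx.
have ev_neq0 : ev h2 ^+ l != 0 by rewrite expf_neq0 ?ev_eq0.
move: def_h => /(congr1 ( *%R^~ (ev h2 ^+ l))).
rewrite def_f expr_div_n [_ * ev P]mulrAC divfK //.
rewrite -!rmorphXn -!rmorphM => /ev_inj def_P.
have dvd_P : h2 ^+ l %| P.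
  by rewrite -(@Gauss_dvdpr _ _ (h1 ^+ l)) ?def_P ?dvdp_mull //
    coprimep_expl ?coprimep_expr.
have /eqP/size_poly1P[c c_neq0 def_h2] := linpoly_powerfree l_gt0 z_prim lt_el dvd_P.
exists (c^-1 *: h1); rewrite evZ def_h2 evC.
by rewrite -(fmorphV (@constL p L)) mulrC.
Qed.

Lemma ev_module (P : L -> Prop) w :
    P 0 -> (forall u v, P u -> P v -> P (u + v)) ->
    (forall c i, (i < l)%N -> P (polyL L c * (x ^+ i * w))) ->
  forall h, P (ev h * w).
Proof.
move=> P0 PD Px h; rewrite /ev /horner_morph horner_coef mulr_suml.
apply: (big_ind P) => // i _; rewrite coef_map /=.
(* Reduction of the exponent: x^i = t^(i div l) x^(i mod l). *)
have -> : constL L h`_i * x ^+ i * w =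
    polyL L ((h`_i)%:P * 'X^(i %/ l)) * (x ^+ (i %% l) * w).
  rewrite rmorphM rmorphXn /= -/(tL L) -x_root -exprM !mulrA.
  by rewrite -[X in _ = X * w]mulrA -exprD mulnC -divn_eq.
by apply: Px; rewrite ltn_mod.
Qed.

End RationalSubfield.

(** * The elements eta_j and alpha, and their l-th powers *)

Section IntegralBasis.

Variables (l p : nat) (zeta : 'F_p).
Hypotheses (l_prime : prime l) (zeta_prim : l.-primitive_root zeta).
Variables (L : fieldExtType (Fpt p)) (x y eta : L).
Hypotheses (x_root : x ^+ l = tL L) (y_root : y ^+ l = 1 - tL L).
Hypothesis eta_root : eta ^+ l = eps l zeta x.

Let l_gt0 : (0 < l)%N := prime_gt0 l_prime.
Let l_gt1 : (1 < l)%N := prime_gt1 l_prime.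

Local Notation Fx := (<<1; x>>%AS : {subfield L}).
Local Notation z := (tofrac zeta%:P : Fpt p).
Local Notation linZ := (linpoly zeta).
Local Notation evx := (ev x).
Local Notation a0 := (alpha l zeta x y eta 0).

Let ev_eq0 := ev_eq0 x_root.

Lemma z_prim : l.-primitive_root z.
Proof. by rewrite (fmorph_primitive_root (@tofrac _ \o polyC)). Qed.

Lemma ev_linpoly n : evx (linZ n) = lin zeta x n.
Proof. by rewrite /linpoly rmorphB rmorph1 /= evZ evX. Qed.

Lemma lin_neq0 n : lin zeta x n != 0.
Proof. by rewrite -ev_linpoly ev_eq0 (linpoly_neq0 l_gt0 zeta_prim). Qed.

Lemma prod_lin j : \prod_(0 <= n < l) lin zeta x (n + j) = y ^+ l.
Proof.
rewrite y_root -x_root; under eq_bigr do rewrite -ev_linpoly.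
by rewrite -rmorph_prod (prod_linpoly l_gt0 zeta_prim) rmorphB rmorph1 rmorphXn /= evX.
Qed.

Lemma y_neq0 : y != 0.
Proof.
have : y ^+ l != 0.
  by rewrite -(prod_lin 0) prodf_seq_neq0; apply/allP => n _; rewrite lin_neq0.
by rewrite expf_eq0 l_gt0.
Qed.

Lemma eta_neq0 : eta != 0.
Proof.
have : eta ^+ l != 0.
  rewrite eta_root prodf_seq_neq0; apply/allP => n _.
  by rewrite expf_neq0 ?lin_neq0.
by rewrite expf_eq0 l_gt0.
Qed.

(** Going from j to j + 1 multiplies the l-th power by u_j^l and divides it by the product of all
    u_n. The exponent of u_(n+j) drops from n to n - 1, while that of u_j rises from 0 to l - 1. *)
Lemma eta_exp j :
  eta_ zeta x y eta j ^+ l = \prod_(1 <= n < l) lin zeta x (n + j) ^+ n.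
Proof.
elim: j => [|j IHj].
  rewrite /eta_ big_geq // expr0 invr1 !mulr1 eta_root.
  by apply: eq_bigr => n _; rewrite addn0.
have -> : eta_ zeta x y eta j.+1 = eta_ zeta x y eta j * lin zeta x j / y.
  by rewrite /eta_ big_nat_recr //= exprSr invfM !mulrA; congr (_ / _); rewrite mulrAC.
rewrite 2!exprMn {}IHj exprVn -(prod_lin j.+1).
(* Wrap-around: the last factor of the shifted product is u_j. *)
have lin_l : lin zeta x (l.-1 + j.+1) = lin zeta x j.
  rewrite addnS -addSn prednK // -!ev_linpoly -(linpoly_mod zeta_prim).
  by rewrite modnDl (linpoly_mod zeta_prim).
set A := \prod_(0 <= n < l) _; have A_neq0 : A != 0.
  by rewrite prodf_seq_neq0; apply/allP => n _; rewrite lin_neq0.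
apply: (canLR (mulfK A_neq0)); rewrite /A.
have -> : \prod_(1 <= n < l) lin zeta x (n + j.+1) ^+ n
    = \prod_(0 <= n < l) lin zeta x (n + j.+1) ^+ n.
  by rewrite [RHS]big_ltn // expr0 mul1r.
rewrite -big_split /= -(prednK l_gt0) [RHS]big_nat_recr //= big_add1 /=.
rewrite lin_l -exprSr; congr (_ * _); apply: eq_bigr => n _.
by rewrite addSnnS -exprSr.
Qed.

Lemma alpha_x i j k : alpha l zeta x y eta i j k = x ^+ i * a0 j k.
Proof. by rewrite /alpha; case: eqP => _; rewrite expr0 !mul1r // !mulrA. Qed.

Lemma alpha_exp i j k : (0 < k < l)%N ->
  alpha l zeta x y eta i j k ^+ l =
    tL L ^+ i * \prod_(1 <= n < l)
      lin zeta x (n + j) ^+ (k * n - l * ((k * n) %/ l)).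
Proof.
case/andP=> k_gt0 _; rewrite /alpha gtn_eqF // 2!exprMn -mulrA.
rewrite exprAC x_root; congr (_ * _).
rewrite exprAC eta_exp -!prodrXl -big_split /=; apply: eq_bigr => n _.
rewrite -exprM -exprVn -exprM [(_ * l)%N]mulnC exprVn mulnC.
(* So the subtraction in the exponent is not truncated. *)
have le_kn : (l * ((k * n) %/ l) <= k * n)%N by rewrite mulnC leq_trunc_div.
by rewrite -{1}(subnK le_kn) exprD mulfK // expf_neq0 ?lin_neq0.
Qed.

(** Brings both cases of [alpha] to the shape required by [integral_rational_powerfree]: all
    exponents are j when k = 0, and kn mod l otherwise. *)
Lemma alpha0_exp j k : (j < l)%N -> (k < l)%N ->
  exists (s : nat) (e : nat -> nat), (forall n, (n < l)%N -> (e n < l)%N) /\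
    a0 j k ^+ l = evx (\prod_(0 <= n < l) linZ (n + s) ^+ e n).
Proof.
move=> lt_jl lt_kl; have [-> | k_gt0] := posnP k.
  exists 0%N, (fun=> j); split=> //; rewrite /alpha eqxx expr0 mul1r exprAC.
  rewrite -(prod_lin 0) prodrXl rmorphXn rmorph_prod /=.
  by under eq_bigr do rewrite -ev_linpoly.
exists j, (fun n => (k * n) %% l)%N; split=> [n _|]; first by rewrite ltn_mod.
rewrite alpha_exp ?k_gt0 // expr0 mul1r rmorph_prod /= [RHS]big_ltn //.
rewrite muln0 mod0n expr0 rmorph1 mul1r; apply: eq_bigr => n _.
by rewrite rmorphXn /= ev_linpoly {1}(divn_eq (k * n) l) [(l * _)%N]mulnC addKn.
Qed.

Lemma lin_mem n : lin zeta x n \in Fx.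
Proof. by rewrite -ev_linpoly ev_mem. Qed.

(* The Kummer class of eta ^+ a * y ^+ b is that of a0 j k with k = a, and
   j determined by a * j + b = 0 mod l when a != 0. *)
Lemma monomial_alpha a b : (a < l)%N -> (b < l)%N ->
  exists j k : 'I_l, exists2 g, g \in Fx & eta ^+ a * y ^+ b = g * a0 j k.
Proof.
move=> lt_al lt_bl; have [-> | a_gt0] := posnP a.
  exists (Ordinal lt_bl), (Ordinal l_gt0), 1; first exact: mem1v.
  by rewrite /alpha !expr0 !mul1r.
have [j lt_jl /dvdnP[m def_m]] : exists2 j, (j < l)%N & (l %| a * j + b)%N.
  have [u v def_gcd _] := egcdnP l a_gt0.
  have cop : gcdn a l = 1%N.
    by apply/eqP; rewrite -/(coprime _ _) coprime_sym prime_coprime // gtnNdvd.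
  (* u is an inverse of a modulo l, so this is -b/a. *)
  exists (u * (l - b) %% l)%N; first by rewrite ltn_mod.
  rewrite /dvdn -modnDml modnMmr mulnA [(a * u)%N]mulnC def_gcd cop modnDml.
  rewrite -/(dvdn _ _) mulnDl mul1n -addnA subnK ?(ltnW lt_bl) //.
  by rewrite dvdn_add // mulnAC dvdn_mull.
exists (Ordinal lt_jl), (Ordinal lt_al) => /=.
rewrite /alpha gtn_eqF // expr0 mul1r.
set B := \prod_(1 <= n < l) _; pose A := \prod_(0 <= n < j) lin zeta x n.
have A_mem : A \in Fx by apply: rpred_prod => n _; apply: lin_mem.
have A_neq0 : A != 0.
  by rewrite prodf_seq_neq0; apply/allP => n _; rewrite lin_neq0.
have B_mem : B \in Fx.
  by apply: rpred_prod => n _; rewrite rpredV rpredX ?lin_mem.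
have B_neq0 : B != 0.
  by rewrite prodf_seq_neq0; apply/allP => n _; rewrite invr_neq0 ?expf_neq0 ?lin_neq0.
(* Here [a0 j a] is eta^a A^a y^(-aj) B, and aj + b = lm turns the leftover power of y into one of
   y^l. *)
exists (A ^- a * B^-1 * (y ^+ l) ^+ m).
  have yl_mem : y ^+ l \in Fx.
    by rewrite -(prod_lin 0); apply: rpred_prod => n _; apply: lin_mem.
  apply: rpredM; last exact: rpredX.
  by apply: rpredM; rewrite rpredV // rpredX.
have -> : eta_ zeta x y eta j ^+ a = eta ^+ a * A ^+ a * y ^- (a * j).
  by rewrite /eta_ !exprMn exprVn -exprM mulnC.
have -> : (y ^+ l) ^+ m = y ^+ (a * j) * y ^+ b.
  by rewrite -exprM mulnC -def_m exprD.
have Aa_neq0 := expf_neq0 a A_neq0; have yj_neq0 := expf_neq0 (a * j) y_neq0.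
move: Aa_neq0 yj_neq0.
move: (A ^+ a) (y ^+ (a * j)) (eta ^+ a) (y ^+ b) => u v e f u_neq0 v_neq0.
by field; rewrite ?u_neq0 ?v_neq0 ?B_neq0.
Qed.

(** * Independence of y and eta modulo l-th powers, and the degree l^3 *)

Local Notation Fxy := (<<Fx; y>>%AS : {subfield L}).
Local Notation Fxeta := (<<Fx; eta>>%AS : {subfield L}).

Let Fx_sub (u v : L) : u \in Fx -> u \in <<Fx; v>>%VS.
Proof. exact/subvP/subv_adjoin. Qed.

(** eta^l and y^l as polynomials in x, written with shift 0 to match [mup_prod_linpoly]. *)
Let epsP := \prod_(0 <= n < l) linZ (n + 0) ^+ n.
Let yP := \prod_(0 <= n < l) linZ (n + 0) ^+ 1.

Let epsP_neq0 : epsP != 0.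
Proof.
rewrite prodf_seq_neq0; apply/allP => n _.
by rewrite expf_neq0 ?(linpoly_neq0 l_gt0 zeta_prim).
Qed.

Let yP_neq0 : yP != 0.
Proof.
rewrite prodf_seq_neq0; apply/allP => n _.
by rewrite expf_neq0 ?(linpoly_neq0 l_gt0 zeta_prim).
Qed.

Let eta_l : eta ^+ l = evx epsP.
Proof.
rewrite eta_root /epsP big_ltn // expr0 mul1r rmorph_prod.
by apply: eq_bigr => n _; rewrite addn0 rmorphXn /= ev_linpoly.
Qed.

Let y_l : y ^+ l = evx yP.
Proof.
by rewrite -(prod_lin 0) rmorph_prod; apply: eq_bigr => n _; rewrite -ev_linpoly.
Qed.

Let mup_epsP n : (n < l)%N -> mup (zeta ^- (n + 0)) epsP = n.
Proof. exact: (mup_prod_linpoly l_gt0 zeta_prim 0 id). Qed.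

Let mup_yP n : (n < l)%N -> mup (zeta ^- (n + 0)) yP = 1%N.
Proof. exact: (mup_prod_linpoly l_gt0 zeta_prim 0 (fun=> 1%N)). Qed.

Let not_lpower (P Q : {poly 'F_p}) n u v w :
    w ^+ l = evx P -> v ^+ l = evx Q -> P != 0 -> Q != 0 ->
    mup (zeta ^- (n + 0)) P = 1%N -> mup (zeta ^- (n + 0)) Q = 0%N ->
  u \in Fx -> w != u * v.
Proof.
move=> w_l v_l P_neq0 Q_neq0 mupP mupQ ux; apply/eqP => def_w.
have : evx P = u ^+ l * evx Q by rewrite -w_l def_w exprMn v_l.
move/(mup_mod_radical l_prime x_root (zeta ^- (n + 0)) ux P_neq0 Q_neq0).
by rewrite mupP mupQ mod0n modn_small.
Qed.

(** The root of u_1 has multiplicity 1 in eta^l. *)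
Lemma eta_notin_Fx : eta \notin Fx.
Proof.
apply/negP => eta_x.
have : eta != eta * 1.
  apply: (not_lpower (P := epsP) (Q := 1) (n := 1)) => //.
  - by rewrite expr1n rmorph1.
  - exact: oner_neq0.
  - exact: mup_epsP.
  by rewrite mupNroot ?root1.
by rewrite mulr1 eqxx.
Qed.

Let eta_l_mem : eta ^+ l \in Fx. Proof. by rewrite eta_l ev_mem. Qed.
Let y_l_mem : y ^+ l \in Fx. Proof. by rewrite y_l ev_mem. Qed.

(** Otherwise y = f eta^b with f in F_p(x); but the root of u_0 has multiplicity 1 in y^l and 0 in
    eta^l. *)
Lemma y_notin_Fxeta : y \notin Fxeta.
Proof.
apply/negP => y_eta.
have [b _ [f fx]] := kummer_radical l_prime z_prim eta_l_mem eta_notin_Fx y_eta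
  y_l_mem y_neq0.
apply/eqP; apply: (not_lpower (P := yP) (Q := epsP ^+ b) (n := 0)) => //.
- by rewrite exprAC eta_l rmorphXn.
- by rewrite expf_neq0 ?epsP_neq0.
- exact: mup_yP.
by rewrite mupX ?epsP_neq0 // mup_epsP // muln0.
Qed.

Let y_notin_Fx : y \notin Fx.
Proof. by apply: contra y_notin_Fxeta; apply: Fx_sub. Qed.

(** Otherwise eta = f y^b, and multiplicities at the root of u_0 give b = 0, against
    [eta_notin_Fx]. *)
Lemma eta_notin_Fxy : eta \notin Fxy.
Proof.
apply/negP => eta_y.
have [b lt_bl [f fx def_eta]] := kummer_radical l_prime z_prim y_l_mem y_notin_Fx
  eta_y eta_l_mem eta_neq0.
have : evx epsP = f ^+ l * evx (yP ^+ b).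
  by rewrite -eta_l def_eta exprMn exprAC y_l rmorphXn.
move/(mup_mod_radical l_prime x_root (zeta ^- (0 + 0)) fx epsP_neq0).
rewrite expf_neq0 ?yP_neq0 // => /(_ isT).
rewrite mupX ?yP_neq0 // mup_epsP // mup_yP // muln1 mod0n modn_small // => b0.
by move: eta_notin_Fx; rewrite def_eta -b0 expr0 mulr1 fx.
Qed.

Local Notation R := (fieldR x y eta).

Lemma fieldRE_eta : R = <<Fxy; eta>>%VS :> {vspace L}.
Proof. by rewrite /fieldR /fieldK /= adjoin_cons adjoin_seq1. Qed.

Lemma fieldRE_y : R = <<Fxeta; y>>%VS :> {vspace L}.
Proof. by rewrite fieldRE_eta adjoinC. Qed.

Lemma dim_fieldR : \dim R = (l * l * l)%N.
Proof.
rewrite fieldRE_eta dim_Fadjoin.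
rewrite (adjoin_degree_kummer l_prime z_prim _ eta_notin_Fxy) ?Fx_sub //.
rewrite dim_Fadjoin (adjoin_degree_kummer l_prime z_prim _ y_notin_Fx) //.
rewrite dim_Fadjoin (adjoin_degree_kummer (E := 1%AS) l_prime z_prim).
- by rewrite dimv1 muln1 mulnA.
- by rewrite x_root; apply/rpredZ/mem1v.
exact: x_notin_base l_prime x_root.
Qed.

(** * Integral elements and their Kummer components *)

Local Notation intL := (integralOver (@polyL p L)).

(** The monic equation of v has coefficients in F_p[t], which f fixes. *)
Lemma integral_kHom (E : {subfield L}) f v :
  kHom 1 E f -> v \in E -> intL v -> intL (f v).
Proof.
move=> homf Ev [q mon_q qv]; exists q => //.
apply: kHom_root_id homf _ Ev qv; first exact: sub1v.
by apply/polyOverP => i; rewrite coef_map /=; apply/rpredZ/mem1v.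
Qed.

Lemma integral_kummer_component (E : {subfield L}) w (e : nat -> L) :
    w ^+ l \in E -> w \notin E -> (forall i, e i \in E) ->
    intL (\sum_(i < l) e i * w ^+ i) ->
  forall i, (i < l)%N -> intL (e i * w ^+ i).
Proof.
move=> wlE wNE eE int_v; apply: (kummer_component l_prime z_prim wlE wNE eE).
- exact: integral0.
- exact: integral_add.
- move=> c u int_u; rewrite -mulr_algl -!rmorphXn.
  by apply: integral_mul int_u; apply: integral_id.
(* The scalar 1/l is a constant of F_p, hence in F_p[t]. *)
- move=> u int_u; rewrite -mulr_algl -(rmorph_nat (@tofrac _ \o polyC)) -fmorphV.
  by apply: integral_mul int_u; apply: integral_id.
move=> f homf; apply: (integral_kHom (E := <<E; w>>%AS)) => //.
  by apply: kHomSl homf; apply: sub1v.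
apply: rpred_sum => i _; apply: rpredM.
  by apply: subvP (eE i); apply: subv_adjoin.
by apply: rpredX; apply: memv_adjoin.
Qed.

Lemma fieldR_span v : v \in R -> exists f : nat -> nat -> L,
  (forall a b, f a b \in Fx) /\
  v = \sum_(b < l) (\sum_(a < l) f a b * eta ^+ a) * y ^+ b.
Proof.
rewrite fieldRE_y => Rv; pose e b := (Fadjoin_poly Fxeta y v)`_b.
exists (fun a b => (Fadjoin_poly Fx eta (e b))`_a); split=> [a b|].
  exact/polyOverP/Fadjoin_polyOver.
rewrite {1}(kummer_span l_prime z_prim (Fx_sub eta y_l_mem) y_notin_Fxeta Rv).
apply: eq_bigr => b _; congr (_ * _).
rewrite {1}/e {1}[LHS](kummer_span l_prime z_prim eta_l_mem eta_notin_Fx) //.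
exact/polyOverP/Fadjoin_polyOver.
Qed.

Local Notation I := ('I_l * 'I_l * 'I_l)%type.
Local Notation al := (fun ijk : I => alpha l zeta x y eta ijk.1.1 ijk.1.2 ijk.2).

Lemma integral_alpha (ijk : I) : intL (al ijk).
Proof.
have int_root u : intL (u ^+ l) -> intL u.
  move=> int_ul; apply: (integral_root_monic (p := 'X^l - (u ^+ l)%:P)).
  - by rewrite monicXnsubC.
  - by rewrite rootE !hornerE subrr.
  apply/integral_poly => i; rewrite coefB coefXn coefC; apply: integral_sub.
    exact: integral_nat.
  by case: (i == 0)%N => //; apply: integral0.
rewrite /= alpha_x; apply: integral_mul.
  by rewrite -[x]evX -rmorphXn; apply: integral_ev x_root _.
apply: int_root.
have [s [e [_ ->]]] := alpha0_exp (ltn_ord ijk.1.2) (ltn_ord ijk.2).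
exact: integral_ev x_root _.
Qed.

Lemma alpha_mem (ijk : I) : al ijk \in R.
Proof.
have x_R : x \in R.
  by rewrite fieldRE_eta; do 2!apply: (subvP (subv_adjoin _ _)); apply: memv_adjoin.
have y_R : y \in R by rewrite fieldRE_y memv_adjoin.
have eta_R : eta \in R by rewrite fieldRE_eta memv_adjoin.
have Fx_R u : u \in Fx -> u \in R.
  by rewrite fieldRE_eta => ux; do 2!apply: (subvP (subv_adjoin _ _)).
have lin_R n : lin zeta x n \in R by rewrite Fx_R ?lin_mem.
rewrite /= alpha_x rpredM ?rpredX // /alpha expr0 !mul1r.
case: ifP => _; first exact: rpredX.
apply: rpredM.
  apply/rpredX/rpredM; last by rewrite rpredV rpredX.
  by apply: rpredM => //; apply: rpred_prod.
by apply: rpred_prod => n _; rewrite rpredV rpredX.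
Qed.

Lemma integral_combination v : v \in R -> intL v ->
  exists c : I -> {poly 'F_p}, v = \sum_ijk polyL L (c ijk) * al ijk.
Proof.
move=> Rv int_v; pose M u := exists c : I -> {poly 'F_p},
  u = \sum_ijk polyL L (c ijk) * al ijk; rewrite -/(M v).
have M0 : M 0.
  by exists (fun=> 0); rewrite big1 // => ijk _; rewrite rmorph0 mul0r.
have MD u u' : M u -> M u' -> M (u + u').
  move=> [c ->] [d ->]; exists (fun ijk => c ijk + d ijk); rewrite -big_split.
  by apply: eq_bigr => ijk _; rewrite rmorphD mulrDl.
have M_alpha c ijk : M (polyL L c * al ijk).
  exists (fun ijk' => if ijk' == ijk then c else 0).
  rewrite (bigD1 ijk) //= eqxx big1 ?addr0 // => ijk' /negPf ->.
  by rewrite rmorph0 mul0r.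
have [f [fx def_v]] := fieldR_span Rv.
rewrite def_v; apply: (big_ind M) => // b _; rewrite mulr_suml.
apply: (big_ind M) => // a _.
(* First the y^b component, over [Fxeta]. *)
have int_b : intL (\sum_(a < l) (f a b * y ^+ b) * eta ^+ a).
  under eq_bigr do rewrite mulrAC; rewrite -mulr_suml.
  apply: (integral_kummer_component (Fx_sub eta y_l_mem) y_notin_Fxeta
    (e := fun b => \sum_(a < l) f a b * eta ^+ a)) => [b'||//].
    apply: rpred_sum => a' _; apply: rpredM; first exact: Fx_sub.
    exact/rpredX/memv_adjoin.
  by rewrite -def_v.
(* With y^b absorbed into the coefficients, this is an expansion in powers of eta over [Fxy]. *)
have int_ab : intL (f a b * eta ^+ a * y ^+ b).
  rewrite mulrAC; apply: (integral_kummer_component (Fx_sub y eta_l_mem)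
    eta_notin_Fxy (e := fun a => f a b * y ^+ b)) => // a'.
  by apply: rpredM; [apply: Fx_sub | apply/rpredX/memv_adjoin].
have [j [k [g gx def_g]]] := monomial_alpha (ltn_ord a) (ltn_ord b).
move: int_ab; rewrite -mulrA def_g mulrA => int_ab.
have [s [e [lt_el def_al]]] := alpha0_exp (ltn_ord j) (ltn_ord k).
have fg_x : f a b * g \in Fx by rewrite rpredM.
have [h ->] := integral_rational_powerfree l_prime x_root zeta_prim fg_x lt_el
  def_al int_ab.
apply: (ev_module l_prime x_root M0 MD) => c i lt_il.
by rewrite -alpha_x; apply: (M_alpha c (Ordinal lt_il, j, k)).
Qed.

(** * Linear independence by counting dimensions *)

Let X := [tuple al (enum_val i) | i < #|{: I}|].

Lemma alpha_free : free X.
Proof.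
apply: (@basis_free _ _ R); rewrite basisEdim; apply/andP; split; last first.
  by rewrite size_tuple !card_prod !card_ord dim_fieldR.
apply/subvP => v Rv; have [f [fx ->]] := fieldR_span Rv.
apply: rpred_sum => b _; rewrite mulr_suml; apply: rpred_sum => a _.
have [j [k [g gx def_g]]] := monomial_alpha (ltn_ord a) (ltn_ord b).
rewrite -mulrA def_g mulrA; have fg_x : f a b * g \in Fx by rewrite rpredM.
have xl_mem : x ^+ l \in 1%VS by rewrite x_root; apply/rpredZ/mem1v.
rewrite (kummer_span (E := 1%AS) l_prime z_prim xl_mem
  (x_notin_base l_prime x_root) fg_x).
rewrite mulr_suml; apply: rpred_sum => i _.
have /vlineP[c ->] := polyOverP (Fadjoin_polyOver 1%AS x (f a b * g)) i.
rewrite mulr_algl -scalerAl -alpha_x; apply/rpredZ/memv_span.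
apply/tnthP; exists (enum_rank (i, j, k)).
by rewrite tnth_mktuple enum_rankK.
Qed.

(** A relation over F_p[t] is one over F_p(t), where [alpha_free] applies. *)
Lemma alpha_independent (c : I -> {poly 'F_p}) :
  \sum_ijk polyL L (c ijk) * al ijk = 0 -> forall ijk, c ijk = 0.
Proof.
move=> sum0 ijk; have /freeP free_X := alpha_free.
apply/eqP; rewrite -tofrac_eq0; apply/eqP.
rewrite -[ijk]enum_rankK; apply: (free_X (fun i => tofrac (c (enum_val i)))).
rewrite -[RHS]sum0 [RHS](reindex (fun i : 'I_#|{: I}| => enum_val i)) /=.
  by apply: eq_bigr => i _; rewrite nth_mktuple mulr_algl.
exact: onW_bij (enum_val_bij _).
Qed.

End IntegralBasis.

Theorem theorem4p9 (l p : nat) (l_prime : prime l) (l_odd : odd l)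
    (p_prime : prime p) (l_dvd : (l %| p - 1)%N)
    (zeta : 'F_p) (zeta_prim : l.-primitive_root zeta)
    (L : fieldExtType (Fpt p)) (x y eta : L)
    (x_root : x ^+ l = tL L) (y_root : y ^+ l = 1 - tL L)
    (eta_root : eta ^+ l = eps l zeta x) :
  is_free_basis (polyL L) (int_closure x y eta)
    (fun ijk : 'I_l * 'I_l * 'I_l =>
       alpha l zeta x y eta ijk.1.1 ijk.1.2 ijk.2)
  /\ (forall i j k : nat, (i < l)%N -> (j < l)%N -> (0 < k < l)%N ->
        alpha l zeta x y eta i j k ^+ l =
        tL L ^+ i * \prod_(1 <= n < l)
          lin zeta x (n + j) ^+ (k * n - l * ((k * n) %/ l))).
Proof.
split; last by move=> i j k _ _; apply: alpha_exp.
split; last exact: alpha_independent.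
move=> v; split=> [[Rv int_v] | [c ->]].
  exact: integral_combination Rv int_v.
split.
  apply: rpred_sum => ijk _; apply: rpredM; first exact/rpredZ/mem1v.
  exact: alpha_mem.
apply: (big_ind (integralOver (@polyL p L))); first exact: integral0.
  exact: integral_add.
move=> ijk _; apply: integral_mul; first exact: integral_id.
exact: integral_alpha.
Qed.
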